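(* Let $\delta$ be a probability distribution over the permutations of an $n$-element set $U$, and let $\rho$ be a permutation output by the Greedy-Rounding procedure on input $\delta$. Then for every $S\subseteq U$ with $|S|=r$, $$\rho(S)\le 2r\cdot\mathbb{E}_{\pi\sim\delta}[\pi(S)].$$
   Context: A permutation $\pi$ of $U$ gives each element $e$ a position $\pi[e]\in\{1,\dots,n\}$; for nonempty $S\subseteq U$, $\pi(S)=\min_{e\in S}\pi[e]$. Assume $r$ divides $n$. Greedy-Rounding on a distribution $\delta$: set $R\leftarrow U$; for $i=1,\dots,n/r$, choose $S^i$ among the $r$-element subsets of $R$ minimizing $\mathbb{E}_{\pi\sim\delta}[\pi(S^i)]$ (ties broken arbitrarily), place the elements of $S^i$ in arbitrary order at positions $(i-1)r+1,\dots,ir$ of $\rho$, and set $R\leftarrow R\setminus S^i$. Output $\rho$. *)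

(* Defs.v *)
From HB Require Import structures.
From mathcomp Require Import all_boot all_order all_algebra.
Set Implicit Arguments.
Unset Strict Implicit.
Unset Printing Implicit Defensive.
Import Order.TTheory GRing.Theory Num.Theory.
Local Open Scope ring_scope.

(* A permutation of U in the sense of a ranking: an injective map to 'I_#|U|,
   which is automatically bijective. *)
Definition ranking (U : finType) : finType :=
  {p : {ffun U -> 'I_#|U|} | injectiveb p}.

(* Positions are counted from 1, hence the successor. *)
Definition pos (U : finType) (p : ranking U) (e : U) : nat := (val p e).+1.

(* Every position is at most #|U|, so the neutral element #|U| does not affect
   the minimum when S is nonempty; for S = set0 the value is meaningless. *)
Definition minpos (U : finType) (p : ranking U) (S : {set U}) : nat :=
  \big[minn/#|U|]_(e in S) pos p e.

Definition is_distr (R : realFieldType) (T : finType) (delta : T -> R) : Prop :=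
  (forall x, 0 <= delta x) /\ \sum_x delta x = 1.

Definition expect (R : realFieldType) (T : finType) (delta X : T -> R) : R :=
  \sum_x delta x * X x.

Definition expect_minpos (R : realFieldType) (U : finType)
    (delta : ranking U -> R) (S : {set U}) : R :=
  expect delta (fun p => (minpos p S)%:R).

Definition greedy_choice (R : realFieldType) (U : finType)
    (delta : ranking U -> R) (r : nat) (rem S : {set U}) : Prop :=
  [/\ S \subset rem, #|S| = r
    & forall T : {set U}, T \subset rem -> #|T| = r ->
        expect_minpos delta S <= expect_minpos delta T].

(* [greedy_blocks delta r rem bs]: starting with remaining set rem, the
   successive iterations may choose the blocks listed in bs. *)
Fixpoint greedy_blocks (R : realFieldType) (U : finType)
    (delta : ranking U -> R) (r : nat) (rem : {set U}) (bs : seq {set U})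
    : Prop :=
  if bs is B :: bs' then
    greedy_choice delta r rem B /\ greedy_blocks delta r (rem :\: B) bs'
  else True.

(* A relation, because ties and the order inside each block are arbitrary.
   Blocks are indexed from 0, so block i occupies positions i*r+1, ..., (i+1)*r;
   since rho is injective and the block has r elements, it fills all of them. *)
Definition greedy_rounding (R : realFieldType) (U : finType)
    (delta : ranking U -> R) (r : nat) (rho : ranking U) : Prop :=
  exists bs : seq {set U},
    [/\ size bs = (#|U| %/ r)%N,
        greedy_blocks delta r [set: U] bs
      & forall (i : nat) (e : U), (i < size bs)%N -> e \in nth set0 bs i ->
          (i * r < pos rho e <= i.+1 * r)%N].

(* Main.v *)
(** Let block [i] be the first greedy block meeting [S], and [k = i + 1]; then
    rho(S) <= k r.  At each of the first [k] steps [S] was still available, so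
    each of the first [k] blocks has expected minimal position at most
    E[pi(S)].  These blocks are disjoint, so for every [pi] their minimal
    positions are [k] distinct positive integers, of sum at least k(k+1)/2.
    Averaging over [pi] gives k(k+1)/2 <= k E[pi(S)]. *)
Require Import Defs.
From HB Require Import structures.
From mathcomp Require Import all_boot all_order all_algebra.
From mathcomp Require Import zify.
Import Order.TTheory GRing.Theory Num.Theory.
Local Open Scope ring_scope.

(** Induction on the size [k]: by pigeonhole some entry is at least [k], and removing it leaves
    [k - 1] distinct positive entries. *)
Lemma leq_sumn_uniq_pos (s : seq nat) :
  uniq s -> 0%N \notin s -> (size s * (size s).+1 <= 2 * sumn s)%N.
Proof.
have [n] := ubnP (size s); elim: n s => // n IHn s le_s_n uniq_s s_pos.
have [->//|s_gt0] := posnP (size s).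
have /hasP[x xs le_x] : has (leq (size s)) s.
  apply/negPn/negP => /hasPn lt_s.
  (* Otherwise [k] distinct entries would fit among the [k - 1] values 1, ..., [k - 1]. *)
  have /(uniq_leq_size uniq_s) : {subset s <= iota 1 (size s).-1}.
    move=> x xs; have := lt_s _ xs; rewrite mem_iota.
    have : x != 0%N by apply: contraNneq s_pos => <-.
    lia.
  by rewrite size_iota leqNgt ltn_predL s_gt0.
have s'_pos : 0%N \notin rem x s.
  by apply: contra s_pos => /mem_rem.
have lt_s'_n : (size (rem x s) < n)%N by rewrite size_rem // prednK.
have := IHn _ lt_s'_n (rem_uniq _ uniq_s) s'_pos.
rewrite size_rem // (perm_sumn (perm_to_rem xs)) /= prednK //.
move: (size s) s_gt0 le_x (sumn _) => k; nia.
Qed.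

Section Minpos.
Variables (U : finType) (p : ranking U).
Implicit Types (e : U) (A B : {set U}).

Lemma pos_inj : injective (pos p).
Proof. by move=> e f [/val_inj]; apply: (injectiveP _ (valP p)). Qed.

Lemma minpos_le B e : e \in B -> (minpos p B <= pos p e)%N.
Proof. by move=> eB; rewrite /minpos -minEnat -leEnat bigmin_le_cond. Qed.

Lemma minpos_attained B : B != set0 -> exists2 e, e \in B & minpos p B = pos p e.
Proof.
case/set0Pn=> e0 e0B; rewrite /minpos -minEnat.
have [|e eB ->] := eq_bigmin (x := #|U| : nat) e0 (mem B) (pos p) e0B; last by exists e.
(* The default [#|U|] is harmless: a position is the successor of an ordinal below [#|U|]. *)
by move=> e _; exact: ltn_ord.
Qed.

Lemma minpos_disjoint A B :
  A != set0 -> B != set0 -> [disjoint A & B] -> minpos p A != minpos p B.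
Proof.
move=> /minpos_attained[e eA ->] /minpos_attained[f fB ->] disAB.
apply/eqP => /pos_inj eq_ef; move/pred0P/(_ e): disAB => /=.
by rewrite eA eq_ef fB.
Qed.

End Minpos.

Section Greedy.
Variables (R : realFieldType) (U : finType) (delta : ranking U -> R) (r : nat).
Hypothesis r_gt0 : (0 < r)%N.
Implicit Types (S : {set U}) (bs : seq {set U}).

Lemma greedy_blocks_sub rem bs B :
  greedy_blocks delta r rem bs -> B \in bs -> B \subset rem /\ #|B| = r.
Proof.
elim: bs rem => //= C bs IH rem [[subC cardC _] gbs].
rewrite inE => /predU1P[->//|/(IH _ gbs)[]].
by rewrite subsetD => /andP[].
Qed.

(** Each block is removed before the next is chosen, so blocks are pairwise disjoint; they are
    nonempty because [r] is positive. *)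
Lemma greedy_blocks_minpos_uniq rem bs p :
  greedy_blocks delta r rem bs -> uniq [seq minpos p B | B <- bs].
Proof.
elim: bs rem => //= C bs IH rem [[subC cardC _] gbs].
rewrite (IH _ gbs) andbT; apply/mapP => -[B /(greedy_blocks_sub _ _ _ gbs)[]].
rewrite subsetD => /andP[_ disBC] cardB; apply/eqP.
by apply: minpos_disjoint; rewrite -?card_gt0 ?cardC ?cardB // disjoint_sym.
Qed.

Lemma greedy_blocks_take rem bs k :
  greedy_blocks delta r rem bs -> greedy_blocks delta r rem (take k bs).
Proof. by elim: bs rem k => [|B bs IH] rem [|k] //= [? /IH]. Qed.

(** As long as [S] misses the chosen blocks it stays a candidate, so each choice costs at most [S].
    The size hypothesis makes the blocks exhaust [rem], so some block meets [S]. *)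
Lemma greedy_blocks_first_hit rem bs S :
  greedy_blocks delta r rem bs -> #|rem| = (r * size bs)%N ->
  S \subset rem -> #|S| = r ->
  exists i e, [/\ (i < size bs)%N, e \in S, e \in nth set0 bs i &
    {in take i.+1 bs, forall B, expect_minpos delta B <= expect_minpos delta S}].
Proof.
elim: bs rem => [|B bs IH] rem /=.
  move=> _ card_rem /subset_leq_card; rewrite card_rem muln0 leqn0 => + cardS.
  by rewrite cardS eqn0Ngt r_gt0.
move=> [[subB cardB minB] gbs] card_rem subS cardS.
have [disSB|] := boolP [disjoint S & B]; last first.
  case/pred0Pn=> e /andP[eS eB]; exists 0%N, e; split=> //= C.
  by rewrite take0 inE => /eqP->; apply: minB.
have card_rem' : #|rem :\: B| = (r * size bs)%N.
  by rewrite cardsD (setIidPr subB) card_rem cardB mulnS addKn.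
have [||i [e [lt_i eS e_i le_S]]] := IH _ gbs card_rem' => //.
  by rewrite subsetD subS.
exists i.+1, e; split=> // C; rewrite inE => /predU1P[->|/le_S//].
exact: minB.
Qed.

Lemma greedy_blocks_expect_sum rem bs :
  is_distr delta -> greedy_blocks delta r rem bs ->
  (size bs * (size bs).+1)%:R <= 2 * \sum_(B <- bs) expect_minpos delta B.
Proof.
move=> [delta_ge0 delta_sum] gbs.
(* Total mass 1 turns the constant into an expectation, so both sides can be compared for each [p]
   separately. *)
have -> : (size bs * (size bs).+1)%:R
          = \sum_p delta p * (size bs * (size bs).+1)%:R.
  by rewrite -mulr_suml delta_sum mul1r.
rewrite exchange_big mulr_sumr /=; apply: ler_sum => p _; rewrite -mulr_sumr mulrCA ler_wpM2l //.
rewrite -natr_sum -natrM ler_nat.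
have := leq_sumn_uniq_pos _ (greedy_blocks_minpos_uniq _ _ p gbs).
rewrite size_map sumnE big_map; apply; apply/mapP => -[B Bbs].
have [_ cardB] := greedy_blocks_sub _ _ _ gbs Bbs.
have B_neq0 : B != set0 by rewrite -card_gt0 cardB.
by have [e _ ->] := minpos_attained _ p B B_neq0.
Qed.

End Greedy.

Theorem theorem6 (R : realFieldType) (U : finType) (r : nat)
    (r_gt0 : (0 < r)%N) (r_dvd : (r %| #|U|)%N)
    (delta : ranking U -> R) (delta_distr : is_distr delta)
    (rho : ranking U) (rho_greedy : greedy_rounding delta r rho)
    (S : {set U}) (cardS : #|S| = r) :
  (minpos rho S)%:R <= 2 * r%:R * expect_minpos delta S.
Proof.
case: rho_greedy => bs [size_bs gbs pos_bs].
have card_U : #|[set: U]| = (r * size bs)%N.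
  by rewrite cardsT size_bs mulnC divnK.
have [i [e [lt_i eS e_i le_S]]] :=
  greedy_blocks_first_hit _ _ _ _ r_gt0 _ _ S gbs card_U (subsetT S) cardS.
have /andP[_ le_pos] := pos_bs _ _ lt_i e_i.
have le_rho : (minpos rho S <= i.+1 * r)%N.
  exact: leq_trans (minpos_le _ _ _ _ eS) le_pos.
(* Only the blocks up to the one meeting [S] are kept, since later ones may cost more than [S]. *)
have := greedy_blocks_expect_sum _ _ _ _ r_gt0 _ _ delta_distr
          (greedy_blocks_take _ _ _ _ _ _ i.+1 gbs).
rewrite size_takel // => le_sum.
have le_k : i.+1%:R <= 2 * expect_minpos delta S.
  have sum_le : \sum_(B <- take i.+1 bs) expect_minpos delta B
                <= i.+1%:R * expect_minpos delta S.
    (* The right side becomes a constant sum over the same prefix, for a termwise comparison. *)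
    rewrite mulr_natl -[X in _ *+ X](size_takel lt_i) -count_predT.
    rewrite -iter_addr_0 -big_const_seq big_seq [leRHS]big_seq.
    exact: ler_sum.
  (* With [k = i.+1], multiply by [k] and use [k * k <= k * k.+1]. *)
  rewrite -(ler_pM2l (ltr0Sn R i)) mulrCA.
  apply: le_trans (ler_wpM2l _ sum_le) => //; apply: le_trans le_sum.
  by rewrite -natrM ler_nat leq_mul2l leqnSn orbT.
rewrite mulrAC; apply: le_trans (ler_wpM2r (ler0n R r) le_k).
by rewrite -natrM ler_nat.
Qed.
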